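(* Let $Q\subset\mathbb R^2$ be a unit square (a closed square region with side length $1$) and let $p\colon[0,1]\to Q$ be a continuous surjective map such that $p(0)$ and $p(1)$ belong to opposite sides of $Q$ (that is, $p(0)$ lies on some side of $Q$ and $p(1)$ lies on the side of $Q$ opposite to it; sides are closed segments and include their endpoints). Then there exist $s,t\in[0,1]$ with $s\neq t$ such that $$\frac{|p(s)-p(t)|^2}{|s-t|}>4 .$$
   Context: $|\cdot|$ denotes the Euclidean norm on $\mathbb R^2$ and the absolute value on $\mathbb R$. For distinct parameters $s\ne t$ of a plane curve $p$, the number $\frac{|p(s)-p(t)|^2}{|s-t|}$ is called the square-linear ratio of the pair. *)

(* Defs.v *)
From HB Require Import structures.
From mathcomp Require Import all_boot all_order all_algebra.
From mathcomp Require Import all_classical all_reals all_analysis.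

Set Implicit Arguments.
Unset Strict Implicit.
Unset Printing Implicit Defensive.

Import Order.TTheory GRing.Theory Num.Theory numFieldNormedType.Exports.

Local Open Scope classical_set_scope.
Local Open Scope ring_scope.

Definition edot (R : realType) (u v : 'rV[R]_2) : R :=
  \sum_(i < 2) u 0 i * v 0 i.

(* Not the norm `|u| of the normed module 'rV[R]_2, which is the sup norm; both
   induce the same topology. *)
Definition enorm (R : realType) (u : 'rV[R]_2) : R := Num.sqrt (edot u u).

(* A unit square in arbitrary position, presented by one of its vertices and
   the two edge vectors issued from that vertex. *)
Record unit_square (R : realType) := UnitSquare {
  sq_vertex : 'rV[R]_2;
  sq_edge1 : 'rV[R]_2;
  sq_edge2 : 'rV[R]_2;
  sq_edge1_unit : enorm sq_edge1 = 1;
  sq_edge2_unit : enorm sq_edge2 = 1;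
  sq_edges_orth : edot sq_edge1 sq_edge2 = 0
}.

Definition sq_point (R : realType) (Q : unit_square R) (x y : R) : 'rV[R]_2 :=
  sq_vertex Q + x *: sq_edge1 Q + y *: sq_edge2 Q.

Definition sq_region (R : realType) (Q : unit_square R) : set 'rV[R]_2 :=
  [set sq_point Q x y | x in `[0, 1] & y in `[0, 1]].

Definition sq_left (R : realType) (Q : unit_square R) : set 'rV[R]_2 :=
  [set sq_point Q 0 y | y in `[0, 1]].
Definition sq_right (R : realType) (Q : unit_square R) : set 'rV[R]_2 :=
  [set sq_point Q 1 y | y in `[0, 1]].
Definition sq_bottom (R : realType) (Q : unit_square R) : set 'rV[R]_2 :=
  [set sq_point Q x 0 | x in `[0, 1]].
Definition sq_top (R : realType) (Q : unit_square R) : set 'rV[R]_2 :=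
  [set sq_point Q x 1 | x in `[0, 1]].

Definition opposite_sides (R : realType) (Q : unit_square R)
    (A B : set 'rV[R]_2) : Prop :=
  [\/ A = sq_left Q /\ B = sq_right Q,
      A = sq_right Q /\ B = sq_left Q,
      A = sq_bottom Q /\ B = sq_top Q |
      A = sq_top Q /\ B = sq_bottom Q].

Definition square_linear_ratio (R : realType) (p : R -> 'rV[R]_2) (s t : R) : R :=
  enorm (p s - p t) ^+ 2 / `|s - t|.

(* Main.v *)
Require Import Defs.
From HB Require Import structures.
From mathcomp Require Import all_boot all_order all_algebra.
From mathcomp Require Import all_classical all_reals all_analysis.
From mathcomp Require Import ring lra.

Set Implicit Arguments.
Unset Strict Implicit.
Unset Printing Implicit Defensive.

Import Order.TTheory GRing.Theory Num.Theory numFieldNormedType.Exports.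

Local Open Scope classical_set_scope.
Local Open Scope ring_scope.

(** If no ratio exceeds 4 then, after stretching time to [0, 4], visits to two
   points at distance d are at least d^2 apart in time.  Summing the squared
   steps start - corner - ... - corner - end, which cannot exceed 4, leaves two
   kinds of orders of the four corners.  In the tight ones (sum exactly 4) the
   times of the corners are known and one or two further points cannot be
   scheduled.  In the others, up to a reflection, (0,1) is visited at q and (1,1)
   at r with 1 <= q < r <= 3.  Then a bottom point (x,0) is visited before q,
   forcing q >= 1 + 2x^2, or after r, forcing 4 - r >= 1 + 2(1-x)^2; as
   r - q >= 1, this for all x gives q = 3/2 and r = 5/2.  Now the curve is nearly
   forced to visit the middle of the bottom side at time 1/4 and the corner (0,0)
   at time 1/2, and symmetrically at the other end, which leaves no time for the
   point (1/2, 1/4). *)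

(* [V t x y] reads: the point (x, y) is visited at time t. *)
Record slow_cover (R : realType) (V : R -> R -> R -> Prop) : Prop := SlowCover {
  slow_sep : forall t x y t' x' y', V t x y -> V t' x' y' ->
    (x - x') ^+ 2 + (y - y') ^+ 2 <= `|t - t'|;
  slow_time : forall t x y, V t x y -> 0 <= t <= 4;
  slow_surj : forall x y, 0 <= x <= 1 -> 0 <= y <= 1 -> exists t, V t x y;
  slow_start : exists y, V 0 0 y;
  slow_end : exists y, V 4 1 y
}.

Section SlowCover.
Variable R : realType.
Implicit Types (V : R -> R -> R -> Prop) (t x y : R).

Lemma slow_flip V : slow_cover V -> slow_cover (fun t x y => V t x (1 - y)).
Proof.
move=> [sep time surj [y0 V0] [y1 V1]]; split.
- move=> t x y t' x' y' Vt Vt'; apply: le_trans (sep _ _ _ _ _ _ Vt Vt').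
  by rewrite le_eqVlt; apply/orP; left; apply/eqP; ring.
- by move=> t x y /time.
- by move=> x y xI yI; apply: surj => //; lra.
- by exists (1 - y0); rewrite subKr.
- by exists (1 - y1); rewrite subKr.
Qed.

Lemma slow_reverse V :
  slow_cover V -> slow_cover (fun t x y => V (4 - t) (1 - x) y).
Proof.
move=> [sep time surj [y0 V0] [y1 V1]]; split.
- move=> t x y t' x' y' Vt Vt'.
  have := sep _ _ _ _ _ _ Vt Vt'.
  have -> : 4 - t - (4 - t') = - (t - t') by ring.
  rewrite normrN; apply: le_trans.
  by rewrite le_eqVlt; apply/orP; left; apply/eqP; ring.
- by move=> t x y /time; lra.
- move=> x y xI yI; have [|t Vt] := surj (1 - x) y _ yI; first by lra.
  by exists (4 - t); rewrite subKr.
- by exists y1; rewrite !subr0.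
- by exists y0; rewrite !subrr.
Qed.

(** Splitting on the order of the two times removes the absolute value and leaves disjunctions that
    [lra] can work through. *)
Lemma slow_gap V t x y t' x' y' : slow_cover V -> V t x y -> V t' x' y' ->
  (t <= t' /\ (x - x') ^+ 2 + (y - y') ^+ 2 <= t' - t) \/
  (t' <= t /\ (x - x') ^+ 2 + (y - y') ^+ 2 <= t - t').
Proof.
move=> cV Vt Vt'; have := slow_sep cV Vt Vt'.
by case: (lerP t t') => h; [left | right]; split=> //; lra.
Qed.

(** Only the abscissas of the two ends of the curve are known, so only the horizontal part of the
    distance to them is kept. *)
Lemma slow_bounds V t x y : slow_cover V -> V t x y ->
  x ^+ 2 <= t /\ (1 - x) ^+ 2 <= 4 - t.
Proof.
move=> cV Vt; have tI := slow_time cV Vt.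
have [y0 V0] := slow_start cV; have [y1 V1] := slow_end cV.
have s0 := sqr_ge0 (y - y0); have s1 := sqr_ge0 (y - y1).
split.
- have : (x - 0) ^+ 2 + (y - y0) ^+ 2 <= `|t - 0| := slow_sep cV Vt V0.
  by rewrite !subr0 ger0_norm; lra.
- have := slow_sep cV Vt V1.
  by rewrite distrC ger0_norm; lra.
Qed.

(* The constant 1/32 is the height of a point of the left side near the corner
   (0,0), visited close to time 1/2, and (1/2 - 1/4096, 0) is a point near the
   middle of the bottom side, visited close to time 1/4. *)
Lemma slow_low_point_late V t : slow_cover V ->
  V (3 / 2) 0 1 -> V (5 / 2) 1 1 -> V t (1 / 2) (1 / 4) -> 3 / 2 < t.
Proof.
move=> cV Vq Vr Vt; rewrite ltNge; apply/negP => tq.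
have [||m Vm] := slow_surj cV (x := 1 / 2 - 1 / 4096) (y := 0); [lra|lra|].
have [||u Vu] := slow_surj cV (x := 0) (y := 1 / 32); [lra|lra|].
have [m0 m4] := slow_bounds cV Vm.
have [u0 u4] := slow_bounds cV Vu.
have [t0 t4] := slow_bounds cV Vt.
(* For the midpoint itself the constraints would still allow a visit at time 15/4; the shift to the
   left excludes it. *)
have mq : m <= 3 / 2 /\ m <= 1 / 2 - (1 / 2 - 1 / 4096) ^+ 2.
  by have := slow_gap cV Vm Vq; have := slow_gap cV Vm Vr; lra.
have uq : u <= 3 / 2 /\ u <= 3 / 2 - (31 / 32) ^+ 2.
  by have := slow_gap cV Vu Vq; have := slow_gap cV Vu Vr; lra.
(* The order [u] before [m] would give [u < 0], because (1/32)^2 exceeds 2/4096. *)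
have um : m + (1 / 2 - 1 / 4096) ^+ 2 <= u.
  by have := slow_gap cV Vu Vm; lra.
(* The gap to (0,1) gives [t <= 11/16], too early for a visit after [u]. Before [u], the time [t] is
   so near 1/4 that the gap to [m] falls below 1/16. *)
have := slow_gap cV Vt Vq; have := slow_gap cV Vt Vu.
by have := slow_gap cV Vt Vm; lra.
Qed.

Lemma slow_bottom_gap V q r x : slow_cover V -> 0 <= x <= 1 ->
  V q 0 1 -> V r 1 1 -> 1 <= q -> q < r -> r <= 3 ->
  2 * x ^+ 2 + 1 <= q \/ 2 * (1 - x) ^+ 2 + 1 <= 4 - r.
Proof.
move=> cV xI Vq Vr q1 qr r3.
have [|t Vt] := slow_surj cV (y := 0) xI; first by lra.
have [t0 t4] := slow_bounds cV Vt.
(* This gives x^2 + (1-x)^2 >= 1/2, so a visit between [q] and [r] would need [r - q >= 5/2],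
   whereas [r - q <= 2]. *)
have s0 := sqr_ge0 (x - 1 / 2).
by have := slow_gap cV Vt Vq; have := slow_gap cV Vt Vr; lra.
Qed.

Lemma slow_top_absurd V q r : slow_cover V ->
  V q 0 1 -> V r 1 1 -> 1 <= q -> q < r -> r <= 3 -> False.
Proof.
move=> cV Vq Vr q1 qr r3.
have gap := slow_gap cV Vq Vr.
have bot x (xI : 0 <= x <= 1) := slow_bottom_gap cV xI Vq Vr q1 qr r3.
(* The abscissa is chosen so that both alternatives read (q - 3/2)^2 <= 0. *)
have q32 : q = 3 / 2.
  have : (q - 3 / 2) ^+ 2 <= 0.
    by case: (bot (q / 2 - 1 / 4)); lra.
  by rewrite real_exprn_even_le0 ?num_real //= subr_eq0 => /eqP.
have r52 : r = 5 / 2.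
  have : (r - 5 / 2) ^+ 2 <= 0.
    by case: (bot (r / 2 - 3 / 4)); lra.
  by rewrite real_exprn_even_le0 ?num_real //= subr_eq0 => /eqP.
subst q r.
have [||t Vt] := slow_surj cV (x := 1 / 2) (y := 1 / 4); [lra|lra|].
have t32 := slow_low_point_late cV Vq Vr Vt.
have t52 : 3 / 2 < 4 - t.
  apply: (slow_low_point_late (slow_reverse cV)).
  - by have -> : 4 - 3 / 2 = 5 / 2 :> R by [lra]; rewrite subr0.
  - by have -> : 4 - 5 / 2 = 3 / 2 :> R by [lra]; rewrite subrr.
  - by rewrite subKr; have -> : 1 - 1 / 2 = 1 / 2 :> R by [lra].
(* Now [t] lies between 3/2 and 5/2, but must be 13/16 away from both. *)
by have := slow_gap cV Vt Vq; have := slow_gap cV Vt Vr; lra.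
Qed.

(** Both vertical sides have their lower corner visited first. Of the six such orders, two exceed
    the total time 4 and four fill it exactly, which fixes all corner times. *)
Lemma slow_cross_absurd V p q r s : slow_cover V ->
  V p 0 0 -> V q 0 1 -> V r 1 1 -> V s 1 0 -> p < q -> s < r -> False.
Proof.
move=> cV Vp Vq Vr Vs pq sr.
have [p0 p4] := slow_bounds cV Vp; have [q0 q4] := slow_bounds cV Vq.
have [r0 r4] := slow_bounds cV Vr; have [s0 s4] := slow_bounds cV Vs.
have gpq := slow_gap cV Vp Vq; have gsr := slow_gap cV Vs Vr.
have gpr := slow_gap cV Vp Vr; have gps := slow_gap cV Vp Vs.
have gqr := slow_gap cV Vq Vr; have gqs := slow_gap cV Vq Vs.
have : [\/ [/\ p = 0, s = 1, r = 2 & q = 3], [/\ s = 1, p = 2, q = 3 & r = 4],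
           [/\ p = 0, q = 1, s = 3 & r = 4] | [/\ p = 0, s = 1, q = 3 & r = 4]].
  case: (ltrP q r) => qr; last by constructor 1; split; lra.
  case: (ltrP s p) => sp; first by constructor 2; split; lra.
  by case: (ltrP q s) => qs; [constructor 3 | constructor 4]; split; lra.
clear gpq gsr gpr gps gqr gqs p0 p4 q0 q4 r0 r4 s0 s4.
case=> -[? ? ? ?]; subst p q r s.
(* The gaps of 5/4 to the right corners, visited at 1 and 2, force [t >= 13/4], while the end of the
   curve requires [t <= 3]. The next case is this one turned by 180 degrees with time reversed. *)
- have [||t Vt] := slow_surj cV (x := 0) (y := 1 / 2); [lra|lra|].
  have [t0 t4] := slow_bounds cV Vt.
  have := slow_gap cV Vt Vp; have := slow_gap cV Vt Vq.
  by have := slow_gap cV Vt Vr; have := slow_gap cV Vt Vs; lra.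
- have [||t Vt] := slow_surj cV (x := 1) (y := 1 / 2); [lra|lra|].
  have [t0 t4] := slow_bounds cV Vt.
  have := slow_gap cV Vt Vp; have := slow_gap cV Vt Vq.
  by have := slow_gap cV Vt Vr; have := slow_gap cV Vt Vs; lra.
(* Both points must be visited between 25/16 and 39/16, a span of 7/8, but their squared distance is
   5/4. The last case exchanges the coordinates. *)
- have [||t Vt] := slow_surj cV (x := 1 / 4) (y := 0); [lra|lra|].
  have [||u Vu] := slow_surj cV (x := 3 / 4) (y := 1); [lra|lra|].
  have tI := slow_time cV Vt; have uI := slow_time cV Vu.
  have ? : 2 <= t <= 39 / 16.
    have := slow_gap cV Vt Vp; have := slow_gap cV Vt Vq.
    by have := slow_gap cV Vt Vr; have := slow_gap cV Vt Vs; lra.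
  have ? : 25 / 16 <= u <= 2.
    have := slow_gap cV Vu Vp; have := slow_gap cV Vu Vq.
    by have := slow_gap cV Vu Vr; have := slow_gap cV Vu Vs; lra.
  by have := slow_gap cV Vt Vu; lra.
- have [||t Vt] := slow_surj cV (x := 0) (y := 1 / 4); [lra|lra|].
  have [||u Vu] := slow_surj cV (x := 1) (y := 3 / 4); [lra|lra|].
  have tI := slow_time cV Vt; have uI := slow_time cV Vu.
  have ? : 2 <= t <= 39 / 16.
    have := slow_gap cV Vt Vp; have := slow_gap cV Vt Vq.
    by have := slow_gap cV Vt Vr; have := slow_gap cV Vt Vs; lra.
  have ? : 25 / 16 <= u <= 2.
    have := slow_gap cV Vu Vp; have := slow_gap cV Vu Vq.
    by have := slow_gap cV Vu Vr; have := slow_gap cV Vu Vs; lra.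
  by have := slow_gap cV Vt Vu; lra.
Qed.

(** If both vertical sides have their corners visited in the same vertical order,
    [slow_cross_absurd] applies up to a flip. Otherwise the two top or the two bottom corners are
    visited between the other two, as in [slow_top_absurd]. *)
Lemma slow_cover_absurd V : ~ slow_cover V.
Proof.
move=> cV.
have [||p Vp] := slow_surj cV (x := 0) (y := 0); [lra|lra|].
have [||q Vq] := slow_surj cV (x := 0) (y := 1); [lra|lra|].
have [||r Vr] := slow_surj cV (x := 1) (y := 1); [lra|lra|].
have [||s Vs] := slow_surj cV (x := 1) (y := 0); [lra|lra|].
have cW := slow_flip cV.
have Wp : V p 0 (1 - 1) by rewrite subrr.
have Ws : V s 1 (1 - 1) by rewrite subrr.
have Wq : V q 0 (1 - 0) by rewrite subr0.
have Wr : V r 1 (1 - 0) by rewrite subr0.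
have [p0 p4] := slow_bounds cV Vp; have [q0 q4] := slow_bounds cV Vq.
have [r0 r4] := slow_bounds cV Vr; have [s0 s4] := slow_bounds cV Vs.
have gpq := slow_gap cV Vp Vq; have gsr := slow_gap cV Vs Vr.
have gpr := slow_gap cV Vp Vr; have gps := slow_gap cV Vp Vs.
have gqr := slow_gap cV Vq Vr; have gqs := slow_gap cV Vq Vs.
case: (ltrP p q) => pq; case: (ltrP s r) => sr.
- exact: (slow_cross_absurd cV Vp Vq Vr Vs).
- by apply: (slow_top_absurd cV Vq Vr); lra.
- by apply: (slow_top_absurd cW Wp Ws); lra.
- by apply: (slow_cross_absurd cW Wq Wp Ws Wr); lra.
Qed.

End SlowCover.

Lemma edot_lin (R : realType) (u v : 'rV[R]_2) (a b : R) :
  edot (a *: u + b *: v) (a *: u + b *: v) =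
  a ^+ 2 * edot u u + 2 * a * b * edot u v + b ^+ 2 * edot v v.
Proof. by rewrite /edot !big_ord_recr !big_ord0 /= !mxE; ring. Qed.

Lemma enorm_sqr (R : realType) (u : 'rV[R]_2) : enorm u ^+ 2 = edot u u.
Proof.
by rewrite /enorm sqr_sqrtr // /edot sumr_ge0 // => i _; rewrite -expr2 sqr_ge0.
Qed.

Lemma sq_point_dist (R : realType) (Q : unit_square R) (x y x' y' : R) :
  enorm (sq_point Q x y - sq_point Q x' y') ^+ 2 = (x - x') ^+ 2 + (y - y') ^+ 2.
Proof.
rewrite enorm_sqr.
have -> : sq_point Q x y - sq_point Q x' y' =
    (x - x') *: sq_edge1 Q + (y - y') *: sq_edge2 Q.
  by apply/rowP => i; rewrite /sq_point !mxE; ring.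
rewrite edot_lin -!enorm_sqr sq_edge1_unit sq_edge2_unit sq_edges_orth.
ring.
Qed.

Theorem theorem1 (R : realType) (Q : unit_square R) (p : R -> 'rV[R]_2)
    (p_continuous : {within `[0, 1], continuous p})
    (p_maps : set_fun `[0, 1] (sq_region Q) p)
    (p_surjective : set_surj `[0, 1] (sq_region Q) p)
    (p_ends : exists A B : set 'rV[R]_2,
       [/\ opposite_sides Q A B, A (p 0) & B (p 1)]) :
  exists s t : R,
    [/\ s \in `[0, 1], t \in `[0, 1], s != t & 4 < square_linear_ratio p s t].
Proof.
apply: contrapT => noex.
pose V t x y := 0 <= t <= 4 /\ p (t / 4) = sq_point Q x y.
have time t x y : V t x y -> 0 <= t <= 4 by case.
have sep t x y t' x' y' : V t x y -> V t' x' y' ->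
    (x - x') ^+ 2 + (y - y') ^+ 2 <= `|t - t'|.
  move=> [tI pt] [tI' pt']; rewrite -(sq_point_dist Q) -pt -pt'.
  have [->|neq] := eqVneq t t'.
    by rewrite !subrr enorm_sqr /edot big1 // => i _; rewrite mxE mul0r.
  have neq4 : t / 4 != t' / 4 by apply: contra_neq neq; lra.
  have d_gt0 : 0 < `|t / 4 - t' / 4| by rewrite normr_gt0 subr_eq0.
  have dE : `|t - t'| = 4 * `|t / 4 - t' / 4|.
    have -> : t - t' = 4 * (t / 4 - t' / 4) by lra.
    by rewrite normrM ger0_norm.
  rewrite dE leNgt -ltr_pdivlMr //; apply/negP => lt4; apply: noex.
  by exists (t / 4), (t' / 4); split=> //; rewrite in_itv /=; lra.
have surj x y : 0 <= x <= 1 -> 0 <= y <= 1 -> exists t, V t x y.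
  move=> xI yI; have : sq_region Q (sq_point Q x y).
    by exists x; [rewrite /= in_itv | exists y; [rewrite /= in_itv|]].
  case/p_surjective => t /=; rewrite in_itv /= => tI pt.
  exists (4 * t); split; first by lra.
  by rewrite mulrAC divff ?mul1r.
have V0 x y : sq_point Q x y = p 0 -> V 0 x y.
  by move=> e; split; [lra | rewrite mul0r].
have V4 x y : sq_point Q x y = p 1 -> V 4 x y.
  by move=> e; split; [lra | rewrite divff].
have [A [B [opp pA pB]]] := p_ends.
(* Reversing time or exchanging the coordinates, as needed, makes the curve run from the left side
   to the right side. *)
case: opp => -[eA eB]; move: pA pB; rewrite {A}eA {B}eB => -[a _ pa] [b _ pb].
- apply: (@slow_cover_absurd _ V); split=> //.
    by exists a; apply: V0.
  by exists b; apply: V4.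
- apply: (@slow_cover_absurd _ (fun t x y => V (4 - t) x y)); split.
  + move=> t x y t' x' y' Vt Vt'; have := sep _ _ _ _ _ _ Vt Vt'.
    by have -> : 4 - t - (4 - t') = - (t - t') by [ring]; rewrite normrN.
  + by move=> t x y /time; lra.
  + move=> x y xI yI; have [t Vt] := surj x y xI yI.
    by exists (4 - t); rewrite subKr.
  + by exists b; rewrite subr0; apply: V4.
  + by exists a; rewrite subrr; apply: V0.
- apply: (@slow_cover_absurd _ (fun t x y => V t y x)); split.
  + by move=> t x y t' x' y' Vt Vt'; rewrite addrC; apply: sep Vt Vt'.
  + by move=> t x y /time.
  + by move=> x y xI yI; apply: surj.
  + by exists a; apply: V0.
  + by exists b; apply: V4.
- apply: (@slow_cover_absurd _ (fun t x y => V (4 - t) y x)); split.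
  + move=> t x y t' x' y' Vt Vt'; have := sep _ _ _ _ _ _ Vt Vt'.
    by rewrite addrC; have -> : 4 - t - (4 - t') = - (t - t') by [ring];
       rewrite normrN.
  + by move=> t x y /time; lra.
  + move=> x y xI yI; have [t Vt] := surj y x yI xI.
    by exists (4 - t); rewrite subKr.
  + by exists b; rewrite subr0; apply: V4.
  + by exists a; rewrite subrr; apply: V0.
Qed.
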